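(* Let $\mu=\frac{-1+\sqrt7 i}{2}$ and $\bar\mu=\frac{-1-\sqrt7 i}{2}$. For every $r\ge0$, $$a_r = \frac14\cdot 2^r + \left(\frac{-7+5\sqrt7 i}{56}\right)\mu^r + \left(\frac{-7-5\sqrt7 i}{56}\right)\bar\mu^r.$$
   Context: The Stern sequence $(s(n))_{n\ge0}$ is defined by $s(0)=0$, $s(1)=1$, $s(2n)=s(n)$, $s(2n+1)=s(n)+s(n+1)$. For $r\ge0$, let $a_r=|\{n: 2^r\le n<2^{r+1},\ 3\mid s(n)\}|$. *)

(* Defs.v *)
From mathcomp Require Import all_boot all_order all_algebra.
From mathcomp Require Import complex reals.
From mathcomp Require Import zify.

Set Implicit Arguments.
Unset Strict Implicit.
Unset Printing Implicit Defensive.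

Import GRing.Theory.

(* The defining recurrence with a recursion bound [k] that is large enough as
   soon as [n <= k]; see [stern0], [stern1], [stern_double] and
   [stern_doubleS] for the equations satisfied by [stern]. *)
Fixpoint stern_rec (k n : nat) : nat :=
  if k is k'.+1 then
    if n <= 1 then n
    else if odd n then stern_rec k' n./2 + stern_rec k' n./2.+1
    else stern_rec k' n./2
  else 0.

Definition stern (n : nat) : nat := stern_rec n n.

Lemma stern_recE (k n : nat) : n <= k -> stern_rec k n = stern n.
Proof.
rewrite /stern; suff H m : n <= k -> n <= m -> stern_rec k n = stern_rec m n.
  by move=> le_nk; apply: H.
elim: k m n => [|k IHk] [|m] [|n] //= le_nk le_nm.
by case: ifP => // n_gt0; case: ifP => odd_n; rewrite !(IHk m) //; lia.
Qed.

Lemma stern0 : stern 0 = 0.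
Proof. by []. Qed.

Lemma stern1 : stern 1 = 1.
Proof. by []. Qed.

Lemma sternE (n : nat) : 1 < n ->
  stern n = if odd n then stern n./2 + stern n./2.+1 else stern n./2.
Proof.
case: n => [|n] // n_gt1; rewrite {1}/stern /= leqNgt n_gt1 /=.
by case: ifP => odd_n; rewrite !stern_recE //; lia.
Qed.

Lemma stern_double (n : nat) : stern (2 * n) = stern n.
Proof.
case: n => [|n] //; rewrite sternE; last by lia.
by rewrite mul2n odd_double doubleK.
Qed.

Lemma stern_doubleS (n : nat) : stern (2 * n).+1 = stern n + stern n.+1.
Proof.
case: n => [|n] //; rewrite sternE; last by lia.
have -> : odd (2 * n.+1).+1 by lia.
by have -> : (2 * n.+1).+1./2 = n.+1 by lia.
Qed.

Definition stern3_count (r : nat) : nat :=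
  #|[set n : 'I_(2 ^ r.+1) | (2 ^ r <= n) && (3 %| stern n)]|.

Local Open Scope ring_scope.
Local Open Scope complex_scope.

Definition mu (R : realType) : R[i] := (- 1 + (Num.sqrt 7)%:C * 'i) / 2.

Definition mubar (R : realType) : R[i] := (- 1 - (Num.sqrt 7)%:C * 'i) / 2.

(* Main.v *)
Require Import Defs.
From mathcomp Require Import all_boot all_order all_algebra.
From mathcomp Require Import complex reals.
From mathcomp Require Import zify ring.

(** The pair (s(n), s(n+1)) = (a, b) has the two successors (a, a+b) and
    (a+b, b), at 2n and 2n+1.  Let A, B, C, D count the n in [2^r, 2^(r+1))
    for which 3 divides a, b, a+2b (that is, a-b), a+b.  Passing from r to r+1
    replaces (A, B, C, D) by (A+D, B+D, A+B, 2C), so A = B throughout and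
    A(r+3) = A(r+2) + 4 A(r), with characteristic polynomial
    X^3 - X^2 - 4 = (X - 2)(X^2 + X + 2); its roots are 2, mu and mubar. *)

Import GRing.Theory.

(** The predicate is arbitrary so that one splitting lemma yields all four recurrences. *)
Definition stern_pair_count (P : nat -> nat -> bool) (r : nat) : nat :=
  \sum_(2 ^ r <= n < 2 ^ r.+1) P (stern n) (stern n.+1).

Lemma sum_nat_double (F : nat -> nat) (m n : nat) : m <= n ->
  \sum_(2 * m <= i < 2 * n) F i = \sum_(m <= i < n) (F (2 * i) + F (2 * i).+1).
Proof.
elim: n => [|n IHn]; first by rewrite leqn0 => /eqP->; rewrite !big_geq.
rewrite leq_eqVlt => /orP[/eqP->|le_mn]; first by rewrite !big_geq.
rewrite [RHS]big_nat_recr //= -IHn // (_ : 2 * n.+1 = (2 * n).+2); last by lia.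
by rewrite !big_nat_recr ?addnA //=; lia.
Qed.

(** Split the block into even and odd indices and pull [P] back along the two successor maps. *)
Lemma stern_pair_countS (P : nat -> nat -> bool) (r : nat) :
  stern_pair_count P r.+1 =
    stern_pair_count (fun a b => P a (a + b)) r
    + stern_pair_count (fun a b => P (a + b) b) r.
Proof.
rewrite /stern_pair_count -big_split (expnS 2 r.+1).
rewrite [X in index_iota X (2 * _)]expnS sum_nat_double.
  apply: eq_bigr => n _ /=.
  by rewrite stern_doubleS (_ : (2 * n).+2 = 2 * n.+1) ?stern_double //; lia.
by rewrite leq_exp2l.
Qed.

Lemma stern_pair_count0 (P : nat -> nat -> bool) : stern_pair_count P 0 = P 1 1.
Proof. by rewrite /stern_pair_count big_nat1. Qed.

Lemma eq_stern_pair_count (P Q : nat -> nat -> bool) (r : nat) :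
  P =2 Q -> stern_pair_count P r = stern_pair_count Q r.
Proof. by move=> eqPQ; apply: eq_bigr => n _; rewrite eqPQ. Qed.

Lemma stern3_countE (r : nat) :
  stern3_count r = stern_pair_count (fun a _ => 3 %| a) r.
Proof.
rewrite /stern3_count /stern_pair_count -sum1dep_card.
rewrite (big_nat_widenl _ 0) // big_mkord big_mkcondr.
by apply: eq_bigr => n _; case: ifP.
Qed.

Definition stern3_fst := stern_pair_count (fun a _ => 3 %| a).
Definition stern3_snd := stern_pair_count (fun _ b => 3 %| b).
Definition stern3_diff := stern_pair_count (fun a b => 3 %| a + 2 * b).
Definition stern3_sum := stern_pair_count (fun a b => 3 %| a + b).

Lemma stern3_fstS (r : nat) : stern3_fst r.+1 = stern3_fst r + stern3_sum r.
Proof. exact: stern_pair_countS. Qed.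

Lemma stern3_sndS (r : nat) : stern3_snd r.+1 = stern3_snd r + stern3_sum r.
Proof. by rewrite addnC; exact: stern_pair_countS. Qed.

(** Modulo 3, a + 2(a+b) is 2b and (a+b) + 2b is a. *)
Lemma stern3_diffS (r : nat) : stern3_diff r.+1 = stern3_fst r + stern3_snd r.
Proof.
rewrite addnC /stern3_diff stern_pair_countS.
by congr (_ + _); apply: eq_stern_pair_count => a b; lia.
Qed.

(** Both successors give the same condition: 2a + b is 2(a + 2b) modulo 3. *)
Lemma stern3_sumS (r : nat) : stern3_sum r.+1 = 2 * stern3_diff r.
Proof.
rewrite mul2n -addnn /stern3_sum stern_pair_countS.
by congr (_ + _); apply: eq_stern_pair_count => a b; lia.
Qed.

Lemma stern3_fst_snd (r : nat) : stern3_fst r = stern3_snd r.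
Proof.
elim: r => [|r IHr]; first by rewrite /stern3_fst /stern3_snd !stern_pair_count0.
by rewrite stern3_fstS stern3_sndS IHr.
Qed.

Lemma stern3_count_rec (r : nat) :
  stern3_count r.+3 = stern3_count r.+2 + 4 * stern3_count r.
Proof.
rewrite !stern3_countE -!/(stern3_fst _) stern3_fstS stern3_sumS stern3_diffS.
by rewrite -stern3_fst_snd; lia.
Qed.

Lemma stern3_count_init :
  [/\ stern3_count 0 = 0, stern3_count 1 = 0 & stern3_count 2 = 2].
Proof.
rewrite !stern3_countE -!/(stern3_fst _) !stern3_fstS stern3_sumS.
(* At level 0 the only pair is (1, 1), so only C is nonzero, and A(2) = 2 C(0) = 2. *)
by rewrite /stern3_fst /stern3_sum /stern3_diff !stern_pair_count0.
Qed.

Local Open Scope ring_scope.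
Local Open Scope complex_scope.

Lemma sqr_sqrt7i (R : realType) : ((Num.sqrt 7)%:C * 'i) ^+ 2 = - 7 :> R[i].
Proof.
rewrite exprMn -rmorphXn /= Num.Theory.sqr_sqrtr ?Num.Theory.ler0n //.
by rewrite sqr_i mulrN1 rmorph_nat.
Qed.

Lemma root_recE (K : comNzRingType) (x : K) (n : nat) :
  x ^+ 2 = - x - 2 -> x ^+ n.+3 = x ^+ n.+2 + 4 * x ^+ n.
Proof.
move=> x2; rewrite -(addn3 n) -(addn2 n) !exprD (exprS x 2) x2 mulrBr mulrN.
by rewrite -expr2 x2; ring.
Qed.

Theorem theorem5p3 (R : realType) (r : nat) :
  (stern3_count r)%:R =
    1 / 4 * 2 ^+ r
    + (- 7 + 5 * (Num.sqrt 7)%:C * 'i) / 56 * mu R ^+ r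
    + (- 7 - 5 * (Num.sqrt 7)%:C * 'i) / 56 * mubar R ^+ r :> R[i].
Proof.
rewrite /mu /mubar -(mulrA 5).
(* From here on only w^2 = -7 is known about [w], so [field] can treat it as a variable. *)
move: ((Num.sqrt 7)%:C * 'i) (sqr_sqrt7i R) => w w2.
have nz2 : 2 != 0 :> R[i] by rewrite Num.Theory.pnatr_eq0.
have nz7 : 7 != 0 :> R[i] by rewrite Num.Theory.pnatr_eq0.
have sqr_half (v : R[i]) :
    v ^+ 2 = - 7 -> ((- 1 + v) / 2) ^+ 2 = - ((- 1 + v) / 2) - 2.
  move=> v2; rewrite expr_div_n sqrrD v2.
  by field; rewrite ?nz2.
have mu2 := sqr_half _ w2.
have mubar2 : ((- 1 - w) / 2) ^+ 2 = - ((- 1 - w) / 2) - 2.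
  by apply: sqr_half; rewrite sqrrN.
have init1 : (- 7 + 5 * w) / 56 * ((- 1 + w) / 2)
    + (- 7 - 5 * w) / 56 * ((- 1 - w) / 2) = - (1 / 2).
  (* The terms linear in [w] cancel; [w ^+ 2] is kept visible for rewriting. *)
  transitivity ((14 + 10 * w ^+ 2) / 112); first by field; rewrite ?nz2 ?nz7.
  by rewrite w2; field; rewrite ?nz2 ?nz7.
have init0 : (- 7 + 5 * w) / 56 + (- 7 - 5 * w) / 56 = - (1 / 4).
  by field; rewrite ?nz2 ?nz7.
have [a0 a1 a2] := stern3_count_init.
move: ((- 7 + 5 * w) / 56) ((- 7 - 5 * w) / 56) init0 init1 => p q.
move: ((- 1 + w) / 2) ((- 1 - w) / 2) mu2 mubar2 => x y mu2 mubar2 init0 init1.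
elim/ltn_ind: r => -[|[|[|r]]] IHr.
- by rewrite a0 !expr0 !mulr1 -addrA init0 subrr.
- by rewrite a1 !expr1 -addrA init1; field; rewrite ?nz2.
- rewrite a2 mu2 mubar2 -addrA.
  (* Since x^2 = -x - 2 and likewise for y, p x^2 + q y^2 = -(p x + q y) - 2(p + q). *)
  transitivity (1 - (- (1 / 2)) - 2 * (- (1 / 4)) : R[i]).
    by field; rewrite ?nz2.
  by rewrite -init0 -init1; field; rewrite ?nz2.
- have lt2 : (r.+2 < r.+3)%N by [].
  have lt0 : (r < r.+3)%N by apply: ltnW; apply: ltnW.
  rewrite stern3_count_rec natrD natrM (IHr _ lt2) (IHr _ lt0).
  (* The powers of the third root, 2, obey the recurrence because 8 = 4 + 4. *)
  rewrite (root_recE _ _ _ mu2) (root_recE _ _ _ mubar2) !(exprS 2).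
  by field; rewrite ?nz2.
Qed.
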